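(* Let $X$ be a non-discrete Fréchet–Urysohn Tychonoff space. If the hyperspace $\mathcal{S}_c(X)$ of nontrivial convergent sequences of $X$ is a Baire space, then the set of isolated points of $X$ is dense in $X$. In particular, $X$ is a Baire space.
   Context: All spaces are Tychonoff (completely regular and Hausdorff). $X$ is Fréchet–Urysohn if whenever $x\in \overline{A}$, some sequence of points of $A$ converges to $x$. A nontrivial convergent sequence of $X$ is a subset $S\subseteq X$ such that $|S|=\omega$, $S$ (as a subspace) has a unique non-isolated point, denoted $x_S$, and $|S\setminus U|<\omega$ for each neighborhood $U$ of $x_S$. Let $\mathcal{CL}(X)$ be the set of all nonempty closed subsets of $X$, with the Vietoris topology: a base consists of the sets $\langle \mathcal{U}\rangle=\{F\in\mathcal{CL}(X): F\subseteq\bigcup\mathcal{U}\text{ and }F\cap U\neq\emptyset\text{ for all }U\in\mathcal{U}\}$, where $\mathcal{U}$ runs over nonempty finite families of nonempty open subsets of $X$. Let $\mathcal{S}_c(X)=\{S\in\mathcal{CL}(X): S\text{ is a nontrivial convergent sequence of }X\}$ with the subspace topology. A space is Baire (has the Baire property) if every countable intersection of dense open subsets is dense. *)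

(* Defs.v *)
From HB Require Import structures.
From mathcomp Require Import all_boot all_classical.
From mathcomp Require Import topology urysohn.

Set Implicit Arguments.
Unset Strict Implicit.
Unset Printing Implicit Defensive.

Local Open Scope classical_set_scope.

(* [completely_regular_space] is stated with uniform separators; by
   [uniform_separatorP] these are exactly the continuous functions to [0, 1]
   separating a point from a closed set. *)
Definition tychonoff_space (X : topologicalType) : Prop :=
  completely_regular_space X /\ hausdorff_space X.

Definition discrete_space (X : topologicalType) : Prop :=
  forall A : set X, open A.

Definition frechet_urysohn_space (X : topologicalType) : Prop :=
  forall (A : set X) (x : X), closure A x ->
    exists2 u : nat -> X, (forall n, A (u n)) & u @ \oo --> x.

Definition baire_space (X : topologicalType) : Prop :=
  forall F : nat -> set X,
    (forall n, open (F n) /\ dense (F n)) -> dense (\bigcap_n F n).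

(* [isolated S] is the set of isolated points of [S] for the subspace topology
   of [S], so [x] is the unique non-isolated point of [S]. *)
Definition nontrivial_convergent_sequence (X : topologicalType) (S : set X) :
    Prop :=
  (S #= [set: nat])%card /\
  exists x : X,
    [/\ S `\` isolated S = [set x]
      & forall U, nbhs x U -> finite_set (S `\` U)].

Section Vietoris.
Variable X : topologicalType.

Definition CL : Type := [set F : set X | closed F /\ F !=set0].

HB.instance Definition _ := Choice.on CL.

Definition vietoris_index : set (set (set X)) :=
  [set U | [/\ finite_set U, U !=set0 & forall V, U V -> open V /\ V !=set0]].

Definition vietoris_basic (U : set (set X)) : set CL :=
  [set F | \val F `<=` \bigcup_(V in U) V /\
           forall V, U V -> (\val F `&` V) !=set0].

Lemma vietoris_basic_cover :
  \bigcup_(U in vietoris_index) vietoris_basic U = [set: CL].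
Proof.
apply/seteqP; split=> // F _.
have [_ [x Fx]] := set_valP F.
exists [set setT].
  split; first exact: finite_set1.
    by exists setT.
  by move=> V ->; split; [exact: openT|exists x].
split; first by move=> y _; exists setT.
by move=> V ->; exists x.
Qed.

Lemma vietoris_basic_join (U V : set (set X)) (F : CL) :
  vietoris_index U -> vietoris_index V ->
  vietoris_basic U F -> vietoris_basic V F ->
  exists W, [/\ vietoris_index W, vietoris_basic W F &
    vietoris_basic W `<=` vietoris_basic U `&` vietoris_basic V].
Proof.
move=> [finU [U0 UU0] oU] [finV _ oV] [FU hU] [FV hV].
pose cU := \bigcup_(A in U) A; pose cV := \bigcup_(B in V) B.
have ocU : open cU by apply: bigcup_open => A /oU[].
have ocV : open cV by apply: bigcup_open => A /oV[].
exists ([set A `&` cV | A in U] `|` [set B `&` cU | B in V]); split.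
- split.
  + by rewrite finite_setU; split; exact: finite_image.
  + by exists (U0 `&` cV); left; exists U0.
  + move=> _ [[A UA <-]|[B VB <-]]; split.
    * by apply: openI => //; case: (oU _ UA).
    * by have [x [Fx Ax]] := hU _ UA; exists x; split=> //; exact: FV.
    * by apply: openI => //; case: (oV _ VB).
    * by have [x [Fx Bx]] := hV _ VB; exists x; split=> //; exact: FU.
- split.
  + move=> x Fx; have [A UA Ax] := FU _ Fx.
    by exists (A `&` cV); [left; exists A|split=> //; exact: FV].
  + move=> _ [[A UA <-]|[B VB <-]].
    * by have [x [Fx Ax]] := hU _ UA; exists x; do 2!split=> //; exact: FV.
    * by have [x [Fx Bx]] := hV _ VB; exists x; do 2!split=> //; exact: FU.
- move=> G [GW hW]; split; split.
  + by move=> x /GW[_ [[A UA <-]|[B VB <-]] [] //]; exists A.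
  + move=> A UA; have [|x [Gx [Ax _]]] := hW (A `&` cV); first by left; exists A.
    by exists x.
  + by move=> x /GW[_ [[A UA <-]|[B VB <-]] [] //]; exists B.
  + move=> B VB; have [|x [Gx [Bx _]]] := hW (B `&` cU); first by right; exists B.
    by exists x.
Qed.

HB.instance Definition _ := @isBaseTopological.Build CL
  (set (set X)) vietoris_index vietoris_basic
  vietoris_basic_cover vietoris_basic_join.

End Vietoris.

(* As a type, [Sc X] carries the library's subspace topology on [set_type]. *)
Definition Sc (X : topologicalType) : set (CL X) :=
  [set F | nontrivial_convergent_sequence (\val F)].
Arguments Sc X : clear implicits.

(* Main.v *)
Require Import Defs.
From mathcomp Require Import all_boot all_classical finmap.
From mathcomp Require Import topology urysohn.

Local Open Scope classical_set_scope.

(** Suppose the isolated points of [X] are not dense. Then some nonempty open set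
    is crowded, i.e. contains no isolated point of [X], and, [X] being Hausdorff,
    it contains two disjoint nonempty open sets [P] and [Q], crowded as well.
    Consider the open set [O] of the sequences contained in [P `|` Q] and meeting
    both [P] and [Q]. The Frechet-Urysohn property makes it nonempty: a
    non-isolated point of [P] is the limit of a sequence inside [P], to which a
    point of [Q] can be added ([Sc_sequence], [Sc_setU_finite]).

    The key fact is that a generic member of [O] meets both [P] and [Q] in
    infinitely many points ([generic_infinite_meet]). Having at least [n] points
    in [P] is an open condition on [S], because in a Hausdorff space [n] points
    are separated by [n] disjoint open sets ([open_hits]). It is also a dense
    condition among the sequences meeting [P]: if [S] lies in some open subset of
    the hyperspace, so does [S] together with any points close enough to a given
    point of [S] ([Sc_enlarge]), and a nonempty open subset of [P] is infinite
    ([crowded_hits]). The Baire property then yields one [S] in [O] satisfying all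
    these conditions, for every [n] and for both [P] and [Q].

    This is absurd: the limit of [S] lies in [P] or in [Q], and since that set is a
    neighborhood of the limit, the other one contains only finitely many points of
    [S].

    Finally, if the isolated points are dense, every dense open set contains all of
    them, so every intersection of dense open sets is dense
    ([dense_isolated_baire]). *)

(** * Convergent sequences as sets *)

Definition points {X : topologicalType} (F : Sc X) : set X := \val (\val F).

(** In a Hausdorff space, a nontrivial convergent sequence is exactly a countably
    infinite converging set, see [converging_sequence] and [sequence_converging].
    Unlike isolated points of a subspace, this form is visibly stable under adding
    finitely many points. *)
Definition converging_set {X : topologicalType} (S : set X) (x : X) : Prop :=
  S x /\ forall U, nbhs x U -> finite_set (S `\` U).

Lemma countable_setU (T : Type) (A B : set T) :
  countable A -> countable B -> countable (A `|` B).
Proof.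
move=> cA cB; rewrite -bigcup2E.
by apply: bigcup_countable => // -[|[|n]] _ /=.
Qed.

Lemma hausdorff_separate {X : topologicalType} (x y : X) :
  hausdorff_space X -> x != y ->
  exists A B : set X, [/\ open A, open B, A x, B y & A `&` B = set0].
Proof.
rewrite open_hausdorff => sepX /sepX[[A B] /= [/set_mem Ax /set_mem By]].
by move=> [oA oB /eqP AB]; exists A, B.
Qed.

Lemma hausdorff_finite_closed {X : topologicalType} (T : set X) :
  hausdorff_space X -> finite_set T -> closed T.
Proof.
move=> /hausdorff_accessible/accessible_finite_set_closed; exact.
Qed.

(** Separate [y] from [x] by disjoint open sets: the one around [y] contains only
    finitely many points of [S], and those other than [y] form a closed set. *)
Lemma nbhs_finite_meet {X : topologicalType} (S : set X) (x y : X) :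
  hausdorff_space X -> converging_set S x -> y != x ->
  exists2 V, nbhs y V & V `&` S `<=` [set y].
Proof.
move=> hX [_ convS] yx.
have [A [B [oA oB Ay Bx AB]]] := hausdorff_separate _ _ hX yx.
have finT : finite_set ((S `\` B) `\ y).
  by apply: finite_setD; apply: convS; exact: open_nbhs_nbhs.
exists (A `&` ~` ((S `\` B) `\ y)).
  apply: open_nbhs_nbhs; split; last by split=> // -[_ /(_ erefl)].
  by apply: openI => //; rewrite openC; exact: hausdorff_finite_closed.
move=> z [[Az zT] Sz]; apply: contrapT => zy; apply: zT.
split=> //; split=> // Bz.
by have : (A `&` B) z by []; rewrite AB.
Qed.

Lemma converging_closed {X : topologicalType} (S : set X) (x : X) :
  hausdorff_space X -> converging_set S x -> closed S.
Proof.
move=> hX convS y clSy; have [->|yx] := eqVneq y x; first by case: convS.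
have [V yV VS] := nbhs_finite_meet _ _ _ hX convS yx.
by have [z [Sz Vz]] := clSy _ yV; have <- : z = y by exact: VS.
Qed.

Lemma converging_sequence {X : topologicalType} (S : set X) (x : X) :
  hausdorff_space X -> converging_set S x ->
  countable S -> infinite_set S -> nontrivial_convergent_sequence S.
Proof.
move=> hX convS cS iS; have [Sx finS] := convS; split; first exact: eq_card_nat.
exists x; split=> //; apply/seteqP; split=> [y [Sy nisoy]|_ ->].
  apply: contrapT => /eqP yx; apply: nisoy; split; first exact: mem_set.
  have [V yV VS] := nbhs_finite_meet _ _ _ hX convS yx.
  exists V => //; apply/seteqP; split=> // _ ->; split=> //.
  exact: nbhs_singleton.
split=> // -[_ [V xV VS]]; apply: iS.
apply: (@sub_finite_set _ _ ((S `\` V) `|` [set x])).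
  move=> y Sy; have [Vy|] := pselect (V y); last by left.
  by right; rewrite -VS.
by rewrite finite_setU; split; [exact: finS|exact: finite_set1].
Qed.

Lemma sequence_converging {X : topologicalType} (S : set X) :
  nontrivial_convergent_sequence S -> exists x, converging_set S x.
Proof.
move=> [_ [x [limS finS]]]; exists x; split=> //.
by case/seteqP: limS => _ /(_ x erefl)[].
Qed.

Lemma points_sequence {X : topologicalType} (F : Sc X) :
  nontrivial_convergent_sequence (points F).
Proof. exact: (set_valP F). Qed.

Lemma Sc_intro {X : topologicalType} (S : set X) (x : X) :
  hausdorff_space X -> converging_set S x ->
  countable S -> infinite_set S -> exists F : Sc X, points F = S.
Proof.
move=> hX convS cS iS.
have clS : closed S /\ S !=set0.
  by split; [exact: converging_closed convS|exists x; case: convS].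
have seqS := converging_sequence _ _ hX convS cS iS.
pose G : CL X := SigSub (mem_set clS).
have GSc : Sc X G by [].
by exists (SigSub (mem_set GSc)).
Qed.

(** Density arguments in the hyperspace modify a sequence in this way only; the
    limit stays the same. *)
Lemma Sc_setU_finite {X : topologicalType} (F : Sc X) (T : set X) :
  hausdorff_space X -> finite_set T ->
  exists F' : Sc X, points F' = points F `|` T.
Proof.
move=> hX finT; have seqF := points_sequence F.
have [x [Fx finF]] := sequence_converging _ seqF.
have [cardF _] := seqF.
apply: (Sc_intro _ x) => //.
- split; first by left.
  move=> U xU; apply: (@sub_finite_set _ _ ((points F `\` U) `|` T)).
    by move=> y [[Fy|Ty] Uy]; [left|right].
  by rewrite finite_setU; split=> //; exact: finF.
- apply: countable_setU; last exact: finite_set_countable.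
  by rewrite /countable (card_le_eql cardF).
- apply: (@sub_infinite_set _ (points F)); first exact: subsetUl.
  by rewrite (eq_finite_set cardF); exact: infinite_nat.
Qed.

(** Since [x] is not isolated, it is in the closure of [U `\ x], and the
    Frechet-Urysohn property applies to that set. *)
Lemma Sc_sequence {X : topologicalType} (x : X) (U : set X) :
  hausdorff_space X -> frechet_urysohn_space X ->
  open U -> U x -> ~ isolated [set: X] x ->
  exists2 F : Sc X, points F `<=` U & points F !=set0.
Proof.
move=> hX fuX oU Ux nisox.
have clx : closure (U `\ x) x.
  move=> V xV; apply: contrapT => UV0; apply: nisox.
  split; first exact: in_setT.
  exists (U `&` V); first by apply: filterI => //; exact: open_nbhs_nbhs.
  rewrite setIT; apply/seteqP; split=> [y [Uy Vy]|_ ->].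
    by apply: contrapT => yx; apply: UV0; exists y.
  by split=> //; exact: nbhs_singleton.
have [u uU ux] := fuX _ _ clx.
pose S := x |` range u.
have SU : S `<=` U by move=> _ [->//|[n _ <-]]; case: (uU n).
have convS : converging_set S x.
  split=> [|V xV]; first by left.
  have [N _ uV] := ux _ xV.
  apply: (@sub_finite_set _ _ (u @` `I_N)); last exact/finite_image/finite_II.
  move=> _ [[->|[n _ <-]] Vn]; first by case: Vn; exact: nbhs_singleton.
  exists n => //=; rewrite ltnNge; apply/negP => Nn; apply: Vn; exact: uV.
have iS : infinite_set S.
  move=> finS.
  have finR : finite_set (range u) by apply: sub_finite_set finS => y; right.
  have : nbhs x (~` range u).
    apply: open_nbhs_nbhs; split.
      by rewrite openC; exact: hausdorff_finite_closed.
    by move=> [n _ unx]; have [_] := uU n; apply.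
  by move=> /ux[N _ /(_ N (leqnn N))]; apply; exists N.
have cS : countable S.
  apply: countable_setU; first exact/finite_set_countable/finite_set1.
  exact: card_image_le.
have [F FS] := Sc_intro _ _ hX convS cS iS.
by exists F; rewrite FS //; exists x; left.
Qed.

(** * Open conditions on convergent sequences *)

Lemma open_Sc_basic {X : topologicalType} (U : set (set X)) :
  vietoris_index U ->
  open [set F : Sc X | points F `<=` \bigcup_(V in U) V /\
                       forall V, U V -> points F `&` V !=set0].
Proof.
move=> iU; exists (vietoris_basic U) => //.
by exists [set U]; [move=> _ ->|rewrite bigcup_set1].
Qed.

(** This is the basic set of the family [set U; setT], unless [U] is empty, when
    that family is not allowed. *)
Lemma open_meets {X : topologicalType} (U : set X) :
  open U -> open [set F : Sc X | points F `&` U !=set0].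
Proof.
move=> oU; have [->|/set0P U0] := eqVneq U set0.
  rewrite (_ : [set F | _] = set0); first exact: open0.
  by apply/seteqP; split=> // F [x []].
rewrite (_ : [set F | _] = [set F : Sc X |
   points F `<=` \bigcup_(V in [set U; setT]) V /\
   forall V, [set U; setT] V -> points F `&` V !=set0]).
  apply: open_Sc_basic; split; [exact: finite_set2|by exists U; left|].
  move=> _ [|] ->; first by split.
  by split; [exact: openT|case: U0 => x _; exists x].
apply/seteqP; split=> [F [x [Fx Ux]]|F [_ mF]]; last by apply: mF; left.
split=> [y _|_ [|] ->]; first by exists setT => //; right.
  by exists x.
by exists x.
Qed.

(** Take a basic neighborhood of [F] in [N], given by a family [U], and a point of
    [F] in [G], lying in some member [V] of [U]: adding points of [G' := V `&` G] to
    [F] does not leave that neighborhood. *)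
Lemma Sc_enlarge {X : topologicalType} (N : set (Sc X)) (F : Sc X) (G : set X) :
  open N -> N F -> open G -> points F `&` G !=set0 ->
  exists G', [/\ open G', G' !=set0, G' `<=` G &
    forall F' : Sc X, points F `<=` points F' ->
      points F' `<=` points F `|` G' -> N F'].
Proof.
move=> [_ [D DI <-] <-] [U DU [FU mF]] oG [x [Fx Gx]].
have [V UV Vx] := FU _ Fx.
have [_ _ oU] := DI _ DU.
exists (V `&` G); split.
- by apply: openI => //; case: (oU _ UV).
- by exists x.
- by move=> y [].
- move=> F' FF' F'F; exists U => //; split=> [y /F'F[/FU//|[Vy _]]|W UW].
    by exists V.
  by have [y [Fy Wy]] := mF _ UW; exists y; split=> //; exact: FF'.
Qed.

(** For [U] open in a Hausdorff space this says that [S `&` U] has at least [n]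
    points: it asks for [n] points of [S] lying in pairwise disjoint open subsets of
    [U]. Splitting off one open set at a time keeps the condition evidently open, and
    spares handling families of [n] sets. *)
Fixpoint hits {X : topologicalType} (n : nat) (U S : set X) : Prop :=
  if n is m.+1 then
    exists P Q : set X, [/\ open P, open Q, P `&` Q = set0, P `|` Q `<=` U &
      S `&` P !=set0 /\ hits m Q S]
  else True.

Lemma hitsS {X : topologicalType} (n : nat) (U V S : set X) :
  U `<=` V -> hits n U S -> hits n V S.
Proof.
case: n => //= n UV [P [Q [oP oQ PQ PQU H]]]; exists P, Q; split=> //.
exact: subset_trans UV.
Qed.

Lemma open_hits {X : topologicalType} (n : nat) (U : set X) :
  open [set F : Sc X | hits n U (points F)].
Proof.
elim: n U => [|n IH] U /=; first exact: openT.
rewrite openE => F [P [Q [oP oQ PQ PQU [FP FQ]]]].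
have nP : nbhs F [set F' : Sc X | points F' `&` P !=set0].
  by apply: open_nbhs_nbhs; split=> //; exact: open_meets.
have nQ : nbhs F [set F' : Sc X | hits n Q (points F')].
  by apply: open_nbhs_nbhs; split=> //; exact: IH.
by apply: filterS2 nP nQ => F' F'P F'Q; exists P, Q.
Qed.

(** The point found in [P] is not in [Q], so it can be removed from [C]. *)
Lemma hits_card {X : topologicalType} (n : nat) (U S : set X) (C : {fset X}) :
  hits n U S -> S `&` U `<=` [set` C] -> (n <= #|` C|)%N.
Proof.
elim: n U C => //= n IH U C [P [Q [oP oQ PQ PQU [[p [Sp Pp]] hQ]]]] SC.
have pC : p \in C by apply: SC; split=> //; apply: PQU; left.
rewrite (cardfsD1 p) pC ltnS; apply: IH hQ _ => y [Sy Qy] /=.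
rewrite !inE; apply/andP; split; last by apply: SC; split=> //; apply: PQU; right.
apply/eqP => yp; have : (P `&` Q) p by split=> //; rewrite -yp.
by rewrite PQ.
Qed.

Lemma hits_infinite {X : topologicalType} (U S : set X) :
  (forall n, hits n U S) -> infinite_set (S `&` U).
Proof.
move=> hS /finite_fsetP[C SC].
have := hits_card _ _ _ C (hS #|` C|.+1).
by rewrite SC ltnn => /(_ (@subset_refl _ _)).
Qed.

(** * Crowded open sets *)

Definition crowded {X : topologicalType} (V : set X) :=
  open V /\ V `&` isolated [set: X] = set0.

Lemma crowded_sub {X : topologicalType} (U V : set X) :
  open U -> U `<=` V -> crowded V -> crowded U.
Proof.
move=> oU UV [_ V0]; split=> //; apply/seteqP; split=> // x [/UV Vx ix].
by rewrite -V0.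
Qed.

Lemma crowded_split {X : topologicalType} (V : set X) :
  hausdorff_space X -> crowded V -> V !=set0 ->
  exists P Q : set X, [/\ crowded P /\ P !=set0, crowded Q /\ Q !=set0,
    P `&` Q = set0 & P `|` Q `<=` V].
Proof.
move=> hX crV [x Vx]; have [oV V0] := crV.
have [y [Vy yx]] : exists y, V y /\ y != x.
  apply: contrapT => nV; have : (V `&` isolated [set: X]) x; last by rewrite V0.
  split=> //; split; first exact: in_setT.
  exists V; first exact: open_nbhs_nbhs.
  rewrite setIT; apply/seteqP; split=> [y Vy|_ ->//].
  by apply: contrapT => /eqP yx; apply: nV; exists y.
have [A [B [oA oB Ay Bx AB]]] := hausdorff_separate _ _ hX yx.
exists (A `&` V), (B `&` V); split.
- split; last by exists y.
  by apply: crowded_sub crV; [exact: openI|exact: subIsetr].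
- split; last by exists x.
  by apply: crowded_sub crV; [exact: openI|exact: subIsetr].
- by rewrite setIACA AB set0I.
- by move=> z [[]|[]].
Qed.

(** Split [V] repeatedly, keeping a point of one half each time and continuing in
    the other half. *)
Lemma crowded_hits {X : topologicalType} (n : nat) (V : set X) :
  hausdorff_space X -> crowded V -> V !=set0 ->
  exists T : set X, [/\ finite_set T, T `<=` V &
    forall S, T `<=` S -> hits n V S].
Proof.
move=> hX; elim: n V => [|n IH] V crV V0.
  by exists set0; split=> //; exact: finite_set0.
have [P [Q [[[oP _] [p Pp]] [crQ Q0] PQ PQV]]] := crowded_split _ hX crV V0.
have [T [finT TQ hT]] := IH _ crQ Q0.
exists (p |` T); split=> [|y [->|/TQ Qy]|S TS /=].
- by rewrite finite_setU; split=> //; exact: finite_set1.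
- by apply: PQV; left.
- by apply: PQV; right.
exists P, Q; split=> //; first by case: crQ.
split; first by exists p; split=> //; apply: TS; left.
by apply: hT => y Ty; apply: TS; right.
Qed.

(** * Generic sequences *)

(** The sequences meeting [U] in at least [n] points are dense only among those
    meeting [U]; adding the interior of the remaining ones makes an open set that is
    dense in the whole hyperspace. *)
Definition hits_or_misses {X : topologicalType} (U : set X) (n : nat) :
    set (Sc X) :=
  [set F | hits n U (points F)] `|`
  [set F : Sc X | points F `&` U = set0]°.

Lemma hits_or_misses_open {X : topologicalType} (U : set X) (n : nat) :
  open (hits_or_misses U n).
Proof. apply: openU; [exact: open_hits|exact: open_interior]. Qed.

Lemma hits_or_misses_dense {X : topologicalType} (U : set X) (n : nat) :
  hausdorff_space X -> crowded U -> dense (hits_or_misses U n).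
Proof.
move=> hX crU N [F0 NF0] oN.
have [[F NF FU]|noN] :=
  pselect (exists2 F, N F & points F `&` U !=set0); last first.
  exists F0; split=> //; right.
  apply: (@filterS _ _ _ N); last exact: open_nbhs_nbhs.
  move=> F NF; apply/eqP; apply: contrapT => /negP/set0P FU; apply: noN.
  by exists F.
have [G [oG G0 GU NG]] := Sc_enlarge _ _ _ oN NF (proj1 crU) FU.
have [T [finT TG hT]] := crowded_hits n _ hX (crowded_sub _ _ oG GU crU) G0.
have [F' F'E] := Sc_setU_finite F T hX finT.
exists F'; split; first by apply: NG; rewrite F'E; [exact: subsetUl|exact: setUS].
by left; apply: hitsS GU _; rewrite F'E; apply: hT; exact: subsetUr.
Qed.

(** One sequence has to serve both sets, so the dense open sets of [U] and those of
    [V] are merged into a single countable family. *)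
Lemma generic_infinite_meet {X : topologicalType} (U V : set X) (O : set (Sc X)) :
  hausdorff_space X -> baire_space (Sc X) ->
  crowded U -> crowded V -> open O -> O !=set0 ->
  exists2 F, O F &
    forall W, W = U \/ W = V -> points F `&` W !=set0 ->
      infinite_set (points F `&` W).
Proof.
move=> hX bS crU crV oO O0.
(* Odd indices deal with [U] and even ones with [V], for every [n]. *)
pose D k := hits_or_misses (if odd k then U else V) k./2.
have [|F [OF DF]] := bS D _ O O0 oO.
  by move=> k; split; [exact: hits_or_misses_open|
    apply: hits_or_misses_dense => //; case: ifP].
exists F => // W WE FW; apply: hits_infinite => n.
have hm : hits_or_misses W n F.
  case: WE => ->.
    by have := DF (true + n.*2)%N I; rewrite /D half_bit_double oddD odd_double.
  by have := DF n.*2 I; rewrite /D odd_double doubleK.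
case: hm => // /interior_subset /= FW0.
by case: FW => x; rewrite FW0.
Qed.

(** * Density of the isolated points *)

Lemma dense_isolated_baire {X : topologicalType} :
  dense (isolated [set: X]) -> baire_space X.
Proof.
move=> dX F dF O O0 oO; have [x [Ox [_ [V xV]]]] := dX O O0 oO.
rewrite setIT => Vx; subst V.
exists x; split=> // n _; have [oF dFn] := dF n.
have x0 : [set x]° !=set0 by exists x.
have [y [yx Fy]] := dFn _ x0 (open_interior _).
by rewrite -(interior_subset yx).
Qed.

Theorem corollary3p8 (X : topologicalType)
  (tychonoffX : tychonoff_space X)
  (fuX : frechet_urysohn_space X)
  (ndX : ~ discrete_space X)
  (baireS : baire_space (Sc X)) :
  dense (isolated [set: X]) /\ baire_space X.
Proof.
suff dX : dense (isolated [set: X]) by split=> //; exact: dense_isolated_baire.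
have [_ hX] := tychonoffX.
move=> W W0 oW; apply/set0P/eqP => WI0.
have [P [Q [[crP [x Px]] [crQ [y Qy]] PQ _]]] :=
  crowded_split _ hX (conj oW WI0) W0.
have [oP P0] := crP; have [oQ _] := crQ.
have nisox : ~ isolated [set: X] x.
  by move=> ix; have : (P `&` isolated [set: X]) x by []; rewrite P0.
have [F0 F0P [z F0z]] := Sc_sequence _ _ hX fuX oP Px nisox.
have [F1 F1E] := Sc_setU_finite F0 [set y] hX (finite_set1 y).
pose O := [set F : Sc X | points F `<=` \bigcup_(V in [set P; Q]) V /\
                       forall V, [set P; Q] V -> points F `&` V !=set0].
have oO : open O.
  apply: open_Sc_basic; split; [exact: finite_set2|by exists P; left|].
  by move=> _ [|] ->; [split=> //; exists x|split=> //; exists y].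
have OF1 : O F1.
  split=> [t|_ [|] ->]; rewrite F1E.
  - by case=> [/F0P Pt|->]; [exists P => //; left|exists Q => //; right].
  - by exists z; split; [left|exact: F0P].
  - by exists y; split=> //; right.
have [F [FPQ mF] iF] := generic_infinite_meet _ _ _ hX baireS crP crQ oO
  (ex_intro _ F1 OF1).
have [l [Fl finF]] := sequence_converging _ (points_sequence F).
have [iP iQ] : infinite_set (points F `&` P) /\ infinite_set (points F `&` Q).
  by split; apply: (iF _ _ (mF _ _)); by [left|right].
(* A neighborhood of the limit [l] misses only finitely many points of [F]. *)
have notin A B :
    A `&` B = set0 -> open A -> infinite_set (points F `&` B) -> ~ A l.
  move=> AB oA iB Al; apply: iB; apply: (@sub_finite_set _ _ (points F `\` A)).
    move=> t [Ft Bt]; split=> // At.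
    by have : (A `&` B) t by []; rewrite AB.
  by apply: finF; exact: open_nbhs_nbhs.
have [_ [|] -> ] := FPQ _ Fl; first exact: notin PQ oP iQ.
by rewrite setIC in PQ; exact: notin PQ oQ iP.
Qed.
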